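(* Let $L$ be an oriented (classical) link with diagram $D$ and all-$A$ ribbon graph $\mathbb{D}$. Suppose that $D$ has $n_+$ positive crossings and $n_-$ negative crossings. There are grading preserving isomorphisms of bigraded abelian groups $$Kh(\mathbb{D})[-n_-]\{n_+-2n_-\}\cong Kh(L)\quad\text{and}\quad \widetilde{Kh}(\mathbb{D})[-n_-]\{n_+-2n_-\}\cong \widetilde{Kh}(L).$$
   Context: **Ribbon graphs.** A ribbon graph $\mathbb{G}$ (always oriented) is a finite nonempty graph (loops and multiple edges allowed) together with an embedding into a closed oriented surface $\Sigma$ whose complement is a disjoint union of open disks; equivalently, a graph with a cyclic order of the half-edges at each vertex. $\Sigma_{\mathbb{G}}$ is a regular neighborhood of $\mathbb{G}$ in $\Sigma$: one disk per vertex and one band per edge. $F(\mathbb{G})$ is the set of boundary components of $\Sigma_{\mathbb{G}}$ (equivalently, faces of $\mathbb G$). A spanning ribbon subgraph $\mathbb{H}$ has the same vertices, a subset of the edges, and inherited cyclic orders; it has its own surface $\Sigma_{\mathbb{H}}$ and set $F(\mathbb{H})$ of boundary components. **Bigraded groups.** For a bigraded abelian group $M=\bigoplus M^{i,j}$ ($i$ homological, $j$ polynomial grading), $(M[r]\{s\})^{i,j}=M^{i-r,j-s}$. $V$ is the free abelian group on $v_+,v_-$ in bigradings $(0,1),(0,-1)$. Define $m:V\otimes V\to V$ by $v_+\otimes v_+\mapsto v_+$, $v_+\otimes v_-\mapsto v_-$, $v_-\otimes v_+\mapsto v_-$, $v_-\otimes v_-\mapsto 0$, and $\Delta:V\to V\otimes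 V$ by $v_+\mapsto v_+\otimes v_-+v_-\otimes v_+$, $v_-\mapsto v_-\otimes v_-$. **Khovanov homology of a ribbon graph.** Let $\mathbb{G}$ have edges $e_1,\dots,e_n$. For $I=(m_1,\dots,m_n)\in\{0,1\}^n$ let $h(I)=\sum m_i$, let $\mathbb{G}(I)$ be the spanning ribbon subgraph with edge set $\{e_i: m_i=1\}$, and $V(\mathbb{G}(I))=V^{\otimes F(\mathbb{G}(I))}[h(I)]\{h(I)\}$. $CKh(\mathbb{G})=\bigoplus_I V(\mathbb{G}(I))$. If $J$ is obtained from $I$ by changing the $k$th coordinate from $0$ to $1$ (a hypercube edge $\xi:I\to J$), then adding the band of $e_k$ merges two boundary components or splits one into two; $d_\xi:V(\mathbb{G}(I))\to V(\mathbb{G}(J))$ is $m$ (merge) or $\Delta$ (split) on the affected factors and the identity on the others. The differential is $d=\sum_\xi(-1)^{|\{i<k:\,m_i=1\}|}d_\xi$; it raises $i$ by 1 and preserves $j$. $Kh(\mathbb{G})$ is the bigraded homology of $CKh(\mathbb G)$. Reduced version: fix a marked point on the boundary of a vertex disk of $\Sigma_{\mathbb{G}}$ away from all bands; each $\Sigma_{\mathbb{G}(I)}$ has a unique boundary component containing it. $\widetilde{CKh}(\mathbb{G})$ is the subcomplex of $CKh(\mathbb{G})$ in which the factor of the marked component is $\mathbb{Z}v_-$, with polynomial grading shifted up by $1$; $\widetilde{Kh}(\mathbb{G})$ is its homology. **All-$A$ ribbon graph.** At a crossing whose over-strand runs from SW to NE and under-strand from SE to NW, the $A$-resolution consists of two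 vertical arcs, joining SW to NW and NE to SE; the $B$-resolution joins SW to SE and NW to NE. Resolving every crossing of $D$ by $A$ gives disjoint circles. At each crossing $x$ place one arrow labeled $x$ on each of the two arcs of the $A$-resolution, both directed from the over-strand end to the under-strand end. $\Sigma_{\mathbb{D}}$ is obtained by taking one disk (vertex) bounded by each circle (as abstract disks) and, for each $x$, gluing a band (edge) along two opposite sides to the two arrows labeled $x$ so that the arrow directions agree with one orientation of the boundary of the band. For classical $D$ the result is orientable, giving the ribbon graph $\mathbb{D}$, whose edges correspond to the crossings of $D$. **Khovanov homology of links.** With crossings $x_1,\dots,x_n$ of $D$, for $I=(m_1,\dots,m_n)\in\{0,1\}^n$ let $D(I)$ be the Kauffman state with the $A$-resolution at $x_i$ if $m_i=0$ and $B$ if $m_i=1$, $|D(I)|$ its number of components, and $CKh(D)=\bigoplus_I V^{\otimes|D(I)|}[h(I)]\{h(I)\}[-n_-]\{n_+-2n_-\}$, where $h(I)=\sum m_i$ and there is one tensor factor $V$ for each component (state circle) of $D(I)$. If $J$ is obtained from $I$ by changing the $k$th coordinate from $0$ to $1$ (a hypercube edge $\xi:I\to J$), then changing the resolution at $x_k$ from $A$ to $B$ merges two state circles of $D(I)$ into one or splits one into two; $d_\xi$ is the map from the summand of $I$ to the summand of $J$ that is $m$ (merge) or $\Delta$ (split) on the affected factors and the identity on the others. The differential of $CKh(D)$ is $d=\sum_\xi(-1)^{|\{i<k:\,m_i=1\}|}d_\xi$. $Kh(L)$ is the homology of $CKh(D)$ (an invariant of $L$). The reduced $\widetilde{Kh}(L)$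 is defined from a marked point on $D$ away from crossings, exactly as in the ribbon graph case. In the reduced statement, the marked point on $\mathbb{D}$ is the point of the all-$A$ state circle corresponding to the marked point on $D$. *)

(* Defs.v *)
From HB Require Import structures.
From mathcomp Require Import all_boot all_order all_algebra.
From mathcomp Require Import boolp.
From mathcomp Require Import zify.

Set Implicit Arguments.
Unset Strict Implicit.
Unset Printing Implicit Defensive.

Import Order.TTheory GRing.Theory Num.Theory.
Local Open Scope ring_scope.

Definition bigraded := int -> int -> zmodType.

(* M[r]{s} *)
Definition shift (r s : int) (M : bigraded) : bigraded :=
  fun i j => M (i - r) (j - s).

Definition bigraded_iso (M N : bigraded) : Prop :=
  exists f : forall i j, {additive M i j -> N i j},
    forall i j, bijective (f i j).

(* A complex of free abelian groups with a finite homogeneous basis; [dcoef s t]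
   is the coefficient of [t] in the differential of [s]. *)
Record complex := Complex {
  gen : finType;
  bideg : gen -> int * int;
  dcoef : gen -> gen -> int
}.

(* C[r]{s} *)
Definition cshift (r s : int) (C : complex) : complex :=
  @Complex (gen C) (fun b => ((bideg b).1 + r, (bideg b).2 + s)) (@dcoef C).

Definition chain (C : complex) : zmodType := {ffun gen C -> int}.

Definition diff (C : complex) (c : chain C) : chain C :=
  [ffun t => \sum_s c s * dcoef s t].

(* Bidegree (i,j) part of the subgroup spanned by the generators in P. *)
Definition homogeneous (C : complex) (P : pred (gen C)) (i j : int) :
    pred (chain C) :=
  fun c => [forall s, (c s != 0) ==> (P s && (bideg s == (i, j)))].

Definition cycles (C : complex) (P : pred (gen C)) (i j : int) :
    pred (chain C) :=
  fun c => homogeneous P i j c && (diff c == 0).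

Lemma diffB (C : complex) (c c' : chain C) : diff (c - c') = diff c - diff c'.
Proof.
apply/ffunP=> t; rewrite !ffunE -sumrB.
by apply: eq_bigr => s _; rewrite !ffunE mulrBl.
Qed.

Lemma homogeneous_zmod (C : complex) (P : pred (gen C)) i j :
  zmod_closed (homogeneous P i j).
Proof.
split=> [|c c' /forallP hc /forallP hc']; apply/forallP=> s; rewrite !ffunE.
  by rewrite eqxx.
apply/implyP; case: (eqVneq (c s) 0) => [->|nz _]; last exact: (implyP (hc s)).
by rewrite sub0r oppr_eq0; exact: (implyP (hc' s)).
Qed.

Lemma cycles_zmod (C : complex) (P : pred (gen C)) i j :
  zmod_closed (cycles P i j).
Proof.
have [h0 hB] := homogeneous_zmod P i j.
split=> [|c c' /andP[hc /eqP dc] /andP[hc' /eqP dc']].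
  by rewrite unfold_in -{2}(subrr 0) diffB subrr eqxx andbT.
by rewrite unfold_in diffB dc dc' subrr eqxx andbT; exact: hB.
Qed.

HB.instance Definition _ (C : complex) (P : pred (gen C)) i j :=
  GRing.isZmodClosed.Build (chain C) (cycles P i j) (cycles_zmod P i j).

Record cycle (C : complex) (P : pred (gen C)) (i j : int) :=
  Cycle { cval : chain C; _ : cval \in cycles P i j }.

HB.instance Definition _ (C : complex) (P : pred (gen C)) i j :=
  [isSub for @cval C P i j].
HB.instance Definition _ (C : complex) (P : pred (gen C)) i j :=
  [Choice of cycle P i j by <:].
HB.instance Definition _ (C : complex) (P : pred (gen C)) i j :=
  [SubChoice_isSubZmodule of cycle P i j by <:].

(* Boundaries, as a subgroup of the cycles; it is the whole image of the
   differential when the latter squares to 0. *)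
Definition boundaries (C : complex) (P : pred (gen C)) (i j : int) :
    pred (cycle P i j) :=
  fun z => `[< exists2 y, homogeneous P (i - 1) j y & diff y = val z >].

Lemma boundaries_zmod (C : complex) (P : pred (gen C)) i j :
  zmod_closed (@boundaries C P i j).
Proof.
have [h0 hB] := homogeneous_zmod P (i - 1) j.
split=> [|z z' /asboolP[y hy dy] /asboolP[y' hy' dy']]; apply/asboolP.
  by exists 0; rewrite // -(subrr 0) diffB !subrr raddf0.
by exists (y - y'); [exact: hB | rewrite diffB dy dy' raddfB].
Qed.

HB.instance Definition _ (C : complex) (P : pred (gen C)) i j :=
  GRing.isZmodClosed.Build (cycle P i j) (@boundaries C P i j)
    (boundaries_zmod P i j).

(* Homology of the subcomplex of C spanned by the generators in P. *)
Definition homology (C : complex) (P : pred (gen C)) : bigraded :=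
  fun i j =>
    Quotient.quot (GRing.ZmodClosed.clone (cycle P i j) (@boundaries C P i j) _).

(* Structure constants of m and Delta; [true] is v_+, [false] is v_-.
   [mcoef a b c] is the coefficient of v_c in m (v_a (x) v_b), and
   [Dcoef c a b] that of v_a (x) v_b in Delta v_c. *)
Definition mcoef (a b c : bool) : int :=
  match a, b, c with
  | true, true, true | true, false, false | false, true, false => 1
  | _, _, _ => 0
  end.

Definition Dcoef (c a b : bool) : int :=
  match c, a, b with
  | true, true, false | true, false, true | false, false, false => 1
  | _, _, _ => 0
  end.

(* [circ I] is the set of circles at the vertex I of the hypercube (I is given
   as the set of coordinates equal to 1); all circles, at all vertices, are
   encoded as subsets of one fixed set X, so that a circle not affected by a
   hypercube edge is literally the same set at both of its ends. *)
Section Cube.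
Variables (n : nat) (X : finType) (circ : {set 'I_n} -> {set {set X}}).

(* The state (I, S) is the basis element of the tensor power of V indexed by
   [circ I] with factor v_+ at the circles in S and v_- at the others. *)
Definition state :=
  {s : {set 'I_n} * {set {set X}} | s.2 \subset circ s.1}.

Definition vertex_of (s : state) : {set 'I_n} := (val s).1.
Definition plus (s : state) : {set {set X}} := (val s).2.

(* The coefficient of t in d_xi s, for xi the hypercube edge from
   [vertex_of s] to [vertex_of t]. *)
Definition edge_coef (s t : state) : int :=
  let P := circ (vertex_of s) in
  let Q := circ (vertex_of t) in
  if plus s :&: (P :&: Q) != plus t :&: (P :&: Q) then 0 else
  match enum (P :\: Q), enum (Q :\: P) with
  | [:: a; b], [:: c] => mcoef (a \in plus s) (b \in plus s) (c \in plus t)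
  | [:: c], [:: a; b] => Dcoef (c \in plus s) (a \in plus t) (b \in plus t)
  | _, _ => 0
  end.

Definition cube_coef (s t : state) : int :=
  \sum_(k | (k \notin vertex_of s) && (vertex_of t == k |: vertex_of s))
    (-1) ^+ #|[set i in vertex_of s | (i < k)%N]| * edge_coef s t.

Definition state_bideg (s : state) : int * int :=
  let h := #|vertex_of s|%:Z in
  (h, #|plus s|%:Z - #|circ (vertex_of s) :\: plus s|%:Z + h).

Definition cube_complex : complex := Complex state_bideg cube_coef.

(* The circle through the marked point p is labelled v_-. *)
Definition marked (p : X) : pred state :=
  fun s => [forall B in circ (vertex_of s), (p \in B) ==> (B \notin plus s)].

End Cube.

Definition components (T : finType) (e : rel T) : {set {set T}} :=
  [set [set y | connect e x y] | x : T].

(* [rot] is the successor for the cyclic order of the half-edges at each vertex,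
   [opp] exchanges the two halves of each edge, and the edges are numbered. *)
Record ribbonGraph := RibbonGraph {
  vertex : finType;
  half : finType;
  nedges : nat;
  attach : half -> vertex;
  rot : half -> half;
  opp : half -> half;
  edge : half -> 'I_nedges;
  vertex_gt0 : (0 < #|vertex|)%N;
  rot_inj : injective rot;
  rotP : forall h h', (attach h == attach h') = fconnect rot h h';
  oppK : involutive opp;
  opp_neq : forall h, opp h != h;
  edgeP : forall h h', (edge h == edge h') = (h' == h) || (h' == opp h);
  edge_surj : forall k, exists h, edge h = k
}.

Section RibbonKhovanov.
Variable G : ribbonGraph.

Definition isolated := {v : vertex G | [forall h, attach (r := G) h != v]}.

(* The arcs into which the bands of G cut the boundaries of the vertex disks:
   [inl h] is the arc from h to [rot h], and [inr v] is the whole boundary of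
   the disk of an isolated vertex v. *)
Definition arc := (half G + isolated)%type.

(* The boundary of the surface of G(I), with its boundary orientation, goes
   through the end of the arc h into the attaching place of g = rot h.  If the
   edge of g is not in I, there is no band there and the next arc is g; else it
   follows the side of the band, and leaves it, the band being orientable, after
   the half-edge opp g. *)
Definition walk (I : {set 'I_(nedges G)}) (a : arc) : arc :=
  match a with
  | inl h => let g := rot h in inl (if edge g \in I then opp g else g)
  | inr v => inr v
  end.

(* F(G(I)); a boundary component is given by the set of arcs it contains. *)
Definition faces (I : {set 'I_(nedges G)}) : {set {set arc}} :=
  components (frel (walk I)).

Definition CKh : complex := cube_complex faces.

Definition Kh : bigraded := homology (C := CKh) predT.

(* Reduced version, for a marked point on the arc p. *)
Definition rKh (p : arc) : bigraded :=
  homology (C := cshift 0 1 CKh) (marked (circ := faces) p).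

End RibbonKhovanov.

(* The end (x, k) is the k-th of the four ends of strands at the crossing x, in
   counterclockwise order; 0 and 2 are on the under-strand, 1 and 3 on the
   over-strand.  Arithmetic on k is modulo 4. *)
Definition dart (n : nat) := ('I_n * 'I_4)%type.

Section Darts.
Variable n : nat.

Definition turn (d : dart n) : dart n := (d.1, d.2 + 1).
Definition across (d : dart n) : dart n := (d.1, d.2 + 2%:R).

(* Each end is joined by the A-resolution to the end which precedes it (over)
   or follows it (under) counterclockwise, and conversely for B. *)
Definition resA (d : dart n) : dart n :=
  (d.1, if odd d.2 then d.2 - 1 else d.2 + 1).
Definition resB (d : dart n) : dart n :=
  (d.1, if odd d.2 then d.2 + 1 else d.2 - 1).

(* [join] gives the edges of the underlying 4-valent graph. *)
Variable join : dart n -> dart n.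

Definition around (d : dart n) : dart n := turn (join d).

Definition adjacent : rel (dart n) :=
  fun d d' => (d' == join d) || (d' == turn d).

(* Each connected component of the 4-valent graph has Euler characteristic 2
   (it is at most 2, so it is enough to compare the sums): there are n vertices,
   2 n edges, and the faces are the orbits of [around]. *)
Definition genus0 : Prop :=
  (n + fcard around predT = n.*2 + (n_comp adjacent predT).*2)%N.

End Darts.

(* Oriented link diagrams on the sphere, up to the relative position of the
   connected components of the diagram, on which nothing below depends.  [out d]
   says that the link is oriented away from the crossing at d; [loose] is the set
   of components without crossings. *)
Record linkDiagram := LinkDiagram {
  ncross : nat;
  loose : finType;
  join : dart ncross -> dart ncross;
  out : dart ncross -> bool;
  joinK : involutive join;
  out_join : forall d, out (join d) = ~~ out d;
  out_across : forall d, out (across d) = ~~ out d;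
  join_planar : genus0 join;
  diagram_gt0 : (0 < ncross + #|loose|)%N
}.

Section LinkKhovanov.
Variable D : linkDiagram.

(* If the under-strand goes from 0 (S) to 2 (N), the crossing is positive when
   the over-strand goes from 3 (W) to 1 (E); reversing both strands preserves the
   sign. *)
Definition positive (x : 'I_(ncross D)) : bool :=
  out (l := D) (x, 1) == out (l := D) (x, 2%:R).

Definition n_plus : nat := #|[set x | positive x]|.
Definition n_minus : nat := #|[set x | ~~ positive x]|.

(* Points of D away from the crossings: next to a dart, or on a component
   without crossings. *)
Definition point := (dart (ncross D) + loose D)%type.

Definition smooth (I : {set 'I_(ncross D)}) (d : dart (ncross D)) :=
  if d.1 \in I then resB d else resA d.

Definition linked (I : {set 'I_(ncross D)}) : rel point :=
  fun p q => match p, q with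
  | inl d, inl d' => (d' == join d) || (d' == smooth I d)
  | _, _ => false
  end.

(* The components of the Kauffman state D(I), as sets of points of D. *)
Definition circles (I : {set 'I_(ncross D)}) : {set {set point}} :=
  components (linked I).

Definition CKhL : complex :=
  cshift (- n_minus%:Z) (n_plus%:Z - 2 * n_minus%:Z) (cube_complex circles).

Definition KhL : bigraded := homology (C := CKhL) predT.

Definition rKhL (p : point) : bigraded :=
  homology (C := cshift 0 1 CKhL) (marked (circ := circles) p).

End LinkKhovanov.

(* An orientation of the surface of the all-A ribbon graph, given by the boundary
   orientation of the disks bounded by the all-A circles: [into d] says that the
   circle through d goes there from the edge of D to the arc of the A-resolution.
   The disks and the band of x are compatible iff the arrows labelled x, which
   go from 1 to 0 and from 3 to 2, both agree or both disagree with it. *)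
Record allA_orientation (D : linkDiagram) := AllAOrientation {
  into : dart (ncross D) -> bool;
  into_join : forall d, into (join d) = ~~ into d;
  into_resA : forall d, into (resA d) = ~~ into d;
  into_band : forall x, into (x, 1) = into (x, 3%:R)
}.


Lemma Z4E (k : 'I_4) :
  [/\ odd (k + 1)%R = ~~ odd k, odd (k - 1)%R = ~~ odd k,
      k + 2%:R = k + 1 + 1 & k + 1 + 1 + 1 + 1 = k].
Proof. by case: k => [[|[|[|[|k]]]] hk] //; split=> //; apply/val_inj. Qed.

Lemma turn_inj n : injective (@turn n).
Proof.
move=> [x k] [y l] E; congr (_, _); first exact: (congr1 fst E).
exact: (addIr _ (congr1 snd E)).
Qed.

Lemma F2_add0 (a b : 'F_2) : (a + b == 0) = (a == b).
Proof. by rewrite addr_eq0 oppr_pchar2 // pchar_Fp. Qed.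

Lemma F2_cycle (a b c d : 'F_2) : a + b + (b + c) + (c + d) + (d + a) = 0.
Proof.
by case: a b c d => [[|[|?]] ?] [[|[|?]] ?] [[|[|?]] ?] [[|[|?]] ?] //;
  apply/val_inj.
Qed.

(* The rows of [compmx e] are the indicators of the classes of [e]; its row space
   is the space of the functions constant on them. *)
Section Invariant.
Variables (T : finType) (e : rel T).
Hypothesis symE : connect_sym e.

Definition compmx : 'M['F_2]_(n_comp e predT, #|T|) :=
  \matrix_(a, i) (connect e (enum_val a) (enum_val i) : nat)%:R.

Lemma compmx_root (a : 'I_(n_comp e predT)) : fingraph.root e (enum_val a) = enum_val a.
Proof. by apply/eqP; have := enum_valP a; rewrite !inE => /andP[]. Qed.

Lemma compmx_free : row_free compmx.
Proof.
apply/row_freeP.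
exists (\matrix_(i, a) (enum_val i == enum_val a :> T : nat)%:R).
apply/matrixP=> a b; rewrite !mxE (bigD1 (enum_rank (enum_val b))) //=.
rewrite !mxE enum_rankK eqxx mulr1 big1 ?addr0 => [|i ne]; last first.
  by rewrite !mxE -(can_eq enum_rankK) enum_valK (negPf ne) mulr0.
by rewrite -(root_connect symE) !compmx_root (inj_eq enum_val_inj).
Qed.

Lemma compmx_sub (u : 'rV['F_2]_#|T|) :
  (forall x y, e x y -> u 0 (enum_rank x) = u 0 (enum_rank y)) ->
  (u <= compmx)%MS.
Proof.
move=> inv_e; have inv x y : connect e x y ->
    u 0 (enum_rank x) = u 0 (enum_rank y).
  case/connectP=> p; elim: p x => [|z p IHp] x /=; first by move=> _ ->.
  by case/andP=> /inv_e -> /IHp IH /IH.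
apply/submxP; exists (\row_a u 0 (enum_rank (enum_val a))).
apply/rowP=> i; rewrite !mxE.
have rP : fingraph.root e (enum_val i) \in [predI (roots e) & predT].
  by rewrite !inE andbT roots_root.
rewrite (bigD1 (enum_rank_in rP (fingraph.root e (enum_val i)))) //=.
rewrite !mxE enum_rankK_in // [connect _ _ _]symE connect_root mulr1.
rewrite big1 ?addr0 => [|a ne].
  by rewrite -(inv _ _ (connect_root e _)) enum_valK.
rewrite !mxE -(root_connect symE) compmx_root.
case: eqP => [ae|_]; last by rewrite mulr0.
by case/eqP: ne; apply: enum_val_inj; rewrite enum_rankK_in.
Qed.

Lemma compmx_inv (u : 'rV['F_2]_#|T|) x y : (u <= compmx)%MS -> connect e x y ->
  u 0 (enum_rank x) = u 0 (enum_rank y).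
Proof.
case/submxP=> w -> xy; rewrite !mxE; apply: eq_bigr => a _.
by rewrite !mxE !enum_rankK (same_connect_r symE xy).
Qed.

End Invariant.

Section Orientability.
Variable D : linkDiagram.
Local Notation n := (ncross D).
Local Notation T := (dart (ncross D)).
Local Notation N := #|{: T}|.
Local Notation face := (around (@join D)).
Local Notation adj := (adjacent (@join D)).
Local Notation "u @ d" := (u 0 (enum_rank d)) (at level 20).

Lemma face_sym : connect_sym (frel face).
Proof. exact: fconnect_sym (inj_comp (@turn_inj n) (inv_inj (@joinK D))). Qed.

Lemma adj_sym : connect_sym adj.
Proof.
suff sub d d' : connect adj d d' -> connect adj d' d by move=> d d'; apply/idP/idP; apply: sub.
case/connectP=> p; elim: p d => [|z p IHp] d /=; first by move=> _ ->.
case/andP=> dz /IHp IH /IH{IH} /connect_trans; apply.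
case/orP: dz => /eqP ->; first by apply: connect1; rewrite /adjacent joinK eqxx.
have: fconnect (@turn n) (turn d) d by rewrite fconnect_sym ?fconnect1 //; exact: turn_inj.
apply: connect_sub => x y /eqP <-.
by apply: connect1; rewrite /adjacent eqxx orbT.
Qed.

Definition phi : 'M['F_2]_N :=
  1%:M + \matrix_(i, l) (enum_val i == join (enum_val l) : nat)%:R.

Lemma phiE m (u : 'M_(m, N)) i d :
  (u *m phi) i (enum_rank d) = u i (enum_rank d) + u i (enum_rank (join d)).
Proof.
rewrite mulmxDr mulmx1 !mxE; congr (_ + _).
rewrite (bigD1 (enum_rank (join d))) //= !mxE !enum_rankK eqxx mulr1.
rewrite big1 ?addr0 // => l ne; rewrite !mxE enum_rankK.
by rewrite -(can_eq enum_rankK) enum_valK (negPf ne) mulr0.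
Qed.

Lemma phi_sq : phi *m phi = 0.
Proof.
apply/matrixP=> i l; rewrite -(enum_valK l) phiE [RHS]mxE.
rewrite -[phi in LHS]mul1mx !phiE joinK addrACA [X in _ + X]addrC.
by apply/eqP; rewrite F2_add0.
Qed.

Lemma phi_tr : phi^T = phi.
Proof.
apply/matrixP=> i l; rewrite !mxE [l == i]eq_sym; congr (_ + (nat_of_bool _)%:R).
by rewrite eq_sym (can2_eq (@joinK D) (@joinK D)).
Qed.

Definition crossmx : 'M['F_2]_(n, N) :=
  \matrix_(x, i) ((enum_val i).1 == x : nat)%:R.

Lemma crossmx_free : row_free crossmx.
Proof.
apply/row_freeP.
exists (\matrix_(i, x) (enum_val i == (x, 0) :> T : nat)%:R).
apply/matrixP=> x y; rewrite !mxE (bigD1 (enum_rank ((y, 0) : T))) //=.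
rewrite !mxE enum_rankK eqxx mulr1 big1 ?addr0 => [|i ne]; last first.
  by rewrite !mxE -(can_eq (@enum_rankK T)) enum_valK (negPf ne) mulr0.
by rewrite eq_sym.
Qed.

Lemma crossmx_inv (u : 'rV['F_2]_N) d : (u <= crossmx)%MS -> u @ d = u @ turn d.
Proof.
by case/submxP=> w ->; rewrite !mxE; apply: eq_bigr => x _; rewrite !mxE !enum_rankK.
Qed.

Lemma crossmx_tr (u : 'rV['F_2]_N) x :
  (u *m crossmx^T) 0 x =
  u @ (x, 0) + u @ (x, 1) + u @ (x, 2%:R) + u @ (x, 3%:R).
Proof.
rewrite mxE (reindex (@enum_rank T)) /=; last exact: onW_bij (@enum_rank_bij T).
rewrite (eq_bigr (fun d => if d.1 == x then u @ d else 0)) => [|d _]; last first.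
  by rewrite !mxE enum_rankK; case: eqP; rewrite (mulr1, mulr0).
rewrite -big_mkcond /=.
rewrite (eq_bigl (fun d : T => (d.1 == x) && predT d.2)) => [|d]; last by rewrite andbT.
rewrite (eq_bigr (fun d : T => u @ (d.1, d.2))) => [|[] //].
rewrite -(pair_big (pred1 x) predT (fun y k => u @ (y, k))) /= big_pred1_eq.
rewrite !big_ord_recl big_ord0 addr0 !addrA.
congr (_ + _ + _ + _); congr (_ @ (_, _));
  exact: val_inj.
Qed.

Lemma bicolouring : exists g : T -> bool,
  (forall d, g (join d) = ~~ g d) /\ (forall d, g (turn d) = ~~ g d).
Proof.
set F := fcard face predT; set c := n_comp adj predT.
have euler : (n + F = n.*2 + c.*2)%N := @join_planar D.
pose Xf := compmx (frel face).
have rkF : (F <= \rank (Xf *m phi) + c)%N.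
  have rkX : \rank Xf = F by apply/eqP/compmx_free/face_sym.
  rewrite -{1}rkX -(mxrank_mul_ker Xf phi) leq_add2l.
  apply: leq_trans (rank_leq_row (compmx adj)); apply: mxrankS.
  apply/rV_subP=> u; rewrite sub_capmx => /andP[uf /sub_kermxP uj].
  have invj d : u @ d = u @ join d.
    by apply/eqP; rewrite -F2_add0 -phiE uj mxE.
  apply: compmx_sub adj_sym _ _ => d d' /orP[/eqP -> // | /eqP ->].
  rewrite invj. apply: (compmx_inv face_sym uf).
  by apply: connect1; rewrite /= /around joinK.
have rkK : (\rank (phi :&: kermx crossmx^T)%MS <= n + c)%N.
  have rkphi : (\rank phi + \rank phi <= 4 * n)%N.
    have: #|{: T}| = (4 * n)%N by rewrite card_prod !card_ord mulnC.
    by move=> <-; apply: mulmx0_rank_max phi_sq.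
  have rkR : (n <= \rank (phi *m crossmx^T) + c)%N.
    rewrite -mxrank_tr trmx_mul trmxK phi_tr.
    have rkC : \rank crossmx = n by apply/eqP/crossmx_free.
    rewrite -{1}rkC -(mxrank_mul_ker crossmx phi) leq_add2l.
    apply: leq_trans (rank_leq_row (compmx adj)); apply: mxrankS.
    apply/rV_subP=> u; rewrite sub_capmx => /andP[uf /sub_kermxP uj].
    apply: compmx_sub adj_sym _ _ => d d' /orP[/eqP -> | /eqP ->].
      by apply/eqP; rewrite -F2_add0 -phiE uj mxE.
    exact: crossmx_inv.
  have := mxrank_mul_ker phi crossmx^T.
  move: rkphi rkR; set a := \rank _; set b := \rank _; set k := \rank _.
  by move: a b k => a b k; lia.
have sub : (Xf *m phi <= phi :&: kermx crossmx^T)%MS.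
  rewrite sub_capmx submxMl /=; apply/sub_kermxP/row_matrixP=> i.
  rewrite row0 !row_mul; set u := row i Xf.
  have uf : (u <= Xf)%MS by exact: row_sub.
  have uE d : u @ join d = u @ turn d.
    apply: (compmx_inv face_sym uf).
    by apply: connect1; rewrite /= /around joinK.
  apply/rowP=> x; rewrite crossmx_tr !phiE !uE [RHS]mxE.
  have -> : turn ((x, 0) : T) = (x, 1) by congr (_, _); apply/val_inj.
  have -> : turn ((x, 1) : T) = (x, 2%:R) by congr (_, _); apply/val_inj.
  have -> : turn ((x, 2%:R) : T) = (x, 3%:R) by congr (_, _); apply/val_inj.
  have -> : turn ((x, 3%:R) : T) = (x, 0) by congr (_, _); apply/val_inj.
  exact: F2_cycle.
have {}sub : (phi :&: kermx crossmx^T <= Xf *m phi)%MS.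
  rewrite -(geq_leqif (mxrank_leqif_sup sub)).
  by move: rkF rkK euler; set a := \rank _; set b := \rank _; move: a b => a b; lia.
pose v : 'rV['F_2]_N := \row_i (out (enum_val i) : nat)%:R.
have vE d : (v *m phi) @ d = 1.
  by rewrite phiE !mxE !enum_rankK out_join; case: (out d); apply/val_inj.
have : (v *m phi <= Xf *m phi)%MS.
  apply: submx_trans sub; rewrite sub_capmx submxMl /=.
  apply/sub_kermxP/rowP=> x; rewrite crossmx_tr !vE mxE; exact/val_inj.
case/submxP=> w wE; pose u := w *m Xf.
have uf : (u <= Xf)%MS by exact: submxMl.
have uj d : u @ join d = 1 + u @ d.
  apply/eqP; rewrite -subr_eq addrC oppr_pchar2 ?pchar_Fp // eq_sym -(vE d).
  by rewrite wE mulmxA phiE.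
have ut d : u @ turn d = u @ join d.
  apply/esym; apply: (compmx_inv face_sym uf).
  by apply: connect1; rewrite /= /around joinK.
exists (fun d => u @ d == 1); split=> d; rewrite ?ut uj;
  by case: (u @ d) => [[|[|k]] hk].
Qed.

Lemma allA_orientable : inhabited (allA_orientation D).
Proof.
have [g [gj gt]] := bicolouring; split.
have g1 x k : g (x, k + 1) = ~~ g (x, k) by rewrite -gt.
have gN x k : g (x, k - 1) = ~~ g (x, k) by rewrite -{2}(subrK 1 k) g1 negbK.
apply: (@AllAOrientation D g gj) => [[x k]|x].
  by rewrite /resA /=; case: ifP.
have -> : 3%:R = 1 + 1 + 1 :> 'I_4 by apply/val_inj.
by rewrite !g1 negbK.
Qed.

End Orientability.

Section AllA.
Variables (D : linkDiagram) (o : allA_orientation D).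
Local Notation n := (ncross D).

(* The arrow (x, b) goes from the over-end 1 (or 3 if b) of x to the under-end 0
   (resp. 2). *)
Definition arrow := ('I_n * bool)%type.
Definition over_end (h : arrow) : dart n := (h.1, if h.2 then 3%:R else 1).
Definition arrow_at (d : dart n) : arrow := (d.1, (1 < d.2)%N).

(* The end of the arrow by which the oriented circle leaves it. *)
Definition exit_end (h : arrow) : dart n :=
  if into o (over_end h) then resA (over_end h) else over_end h.

Definition allA_rot (h : arrow) : arrow := arrow_at (join (exit_end h)).
Definition allA_opp (h : arrow) : arrow := (h.1, ~~ h.2).

Definition allA_circle := {c : {set point D} | c \in circles set0}.

Lemma circle_subproof (p : point D) :
  [set q | connect (linked set0) p q] \in circles set0.
Proof. exact: imset_f. Qed.

Definition circle_at (p : point D) : allA_circle :=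
  exist (fun c => c \in circles set0) _ (circle_subproof p).

Definition allA_attach (h : arrow) : allA_circle := circle_at (inl (over_end h)).

Lemma resAK : involutive (@resA n).
Proof.
by case=> x [[|[|[|[|k]]]] hk] //; rewrite /resA /=; congr (_, _); apply/val_inj.
Qed.

Lemma resBK : involutive (@resB n).
Proof.
by case=> x [[|[|[|[|k]]]] hk] //; rewrite /resB /=; congr (_, _); apply/val_inj.
Qed.

Lemma over_endK h : arrow_at (over_end h) = h.
Proof. by case: h => x []. Qed.

Lemma arrow_resA d : arrow_at (resA d) = arrow_at d.
Proof. by case: d => x [[|[|[|[|k]]]] hk]. Qed.

Lemma over_arrow d : over_end (arrow_at d) = d \/ over_end (arrow_at d) = resA d.
Proof.
by case: d => x [[|[|[|[|k]]]] hk] //; [right | left | right | left];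
  congr (_, _); apply/val_inj.
Qed.

Lemma exit_arrow h : arrow_at (exit_end h) = h.
Proof. by rewrite /exit_end; case: ifP; rewrite ?arrow_resA over_endK. Qed.

Lemma exit_into h : into o (exit_end h) = false.
Proof. by rewrite /exit_end; case: ifP => // oh; rewrite into_resA oh. Qed.

Lemma exitK d : into o d = false -> exit_end (arrow_at d) = d.
Proof.
rewrite /exit_end; case: (over_arrow d) => -> od; first by rewrite od.
by rewrite into_resA od resAK.
Qed.

Lemma allA_rot_inj : injective allA_rot.
Proof.
move=> h h' E; suff Ej : join (exit_end h) = join (exit_end h').
  by rewrite -(exit_arrow h) (inv_inj (@joinK D) Ej) exit_arrow.
have K d : into o d -> resA (exit_end (arrow_at d)) = d.
  by move=> od; rewrite -arrow_resA exitK ?resAK // into_resA od.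
rewrite -(K (join (exit_end h))) ?into_join ?exit_into //.
rewrite -(K (join (exit_end h'))) ?into_join ?exit_into //.
by congr (resA (exit_end _)).
Qed.

Lemma linked_sym (I : {set 'I_n}) : symmetric (linked I).
Proof.
have sK : involutive (smooth I).
  move=> d; rewrite /smooth; case dI: (d.1 \in I).
    by rewrite [(resB d).1]/= dI; exact: resBK.
  by rewrite [(resA d).1]/= dI; exact: resAK.
move=> [d|f] [d'|f'] //=.
congr (_ || _); first by rewrite eq_sym (can2_eq (@joinK D) (@joinK D)).
by rewrite eq_sym (can2_eq sK sK).
Qed.

Lemma circle_atE p q :
  (circle_at p == circle_at q) = connect (linked set0) p q.
Proof.
have sym := sym_connect_sym (linked_sym set0).
apply/eqP/idP => [/(congr1 val)/setP/(_ q)|pq]; first by rewrite !inE connect0.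
by apply/val_inj/setP=> r; rewrite !inE (same_connect sym pq).
Qed.

Lemma linked_over d : connect (linked set0) (inl d) (inl (over_end (arrow_at d))).
Proof.
case: (over_arrow d) => -> //; apply: connect1.
by rewrite /= /smooth inE eqxx orbT.
Qed.

Lemma allA_rotP h h' : (allA_attach h == allA_attach h') = fconnect allA_rot h h'.
Proof.
have sym := sym_connect_sym (linked_sym set0).
have rsym := fconnect_sym allA_rot_inj.
rewrite circle_atE; apply/idP/idP.
  have step d : fconnect allA_rot (arrow_at d) (arrow_at (join d)).
    case od: (into o d); last by rewrite -{2}(exitK od) fconnect1.
    rewrite rsym -{2}(joinK d) -{2}(@exitK (join d)) ?fconnect1 //.
    by rewrite into_join od.
  suff: forall q, connect (linked set0) (inl (over_end h)) q ->
      if q is inl d then fconnect allA_rot h (arrow_at d) else true.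
    by move=> /(_ (inl (over_end h'))) /[apply]; rewrite over_endK.
  move=> q /connectP[p pth ->]; elim/last_ind: p pth => [|p z IHp] /=.
    by rewrite over_endK connect0.
  rewrite rcons_path last_rcons => /andP[/IHp{IHp}].
  case: (last _ p) z => [d|f] [d'|f'] //= hd /orP[] /eqP -> //.
    exact: connect_trans hd (step d).
  by rewrite /smooth inE arrow_resA.
case/connectP=> p; elim: p h => [|z p IHp] h /=; first by move=> _ ->.
case/andP=> /eqP <- /IHp IH /IH; apply: connect_trans.
have hx : connect (linked set0) (inl (over_end h)) (inl (exit_end h)).
  by rewrite sym -{2}(exit_arrow h) linked_over.
apply: connect_trans hx (connect_trans _ (linked_over _)).
by apply: connect1; rewrite /= eqxx.
Qed.

Lemma allA_gt0 : (0 < #|{: allA_circle}|)%N.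
Proof.
suff [p] : inhabited (point D) by apply/card_gt0P; exists (circle_at p).
have := diagram_gt0 D; rewrite addn_gt0 => /orP[n0|/card_gt0P[f _]].
  by split; left; exact: (Ordinal n0, 0).
by split; right.
Qed.

Lemma allA_oppK : involutive allA_opp.
Proof. by case=> x b; rewrite /allA_opp negbK. Qed.

Lemma allA_opp_neq h : allA_opp h != h.
Proof. by case: h => x []; rewrite xpair_eqE andbF. Qed.

Lemma allA_edgeP (h h' : arrow) :
  (h.1 == h'.1) = (h' == h) || (h' == allA_opp h).
Proof.
case: h h' => [x b] [y c]; rewrite !xpair_eqE -andb_orr eq_sym /=.
by case: b c => [] []; rewrite andbT.
Qed.

Lemma allA_edge_surj (k : 'I_n) : exists h : arrow, h.1 = k.
Proof. by exists (k, true). Qed.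

(* The edge of the all-A ribbon graph at x, the two arrows labelled x being its
   half-edges, is numbered as the crossing x. *)
Definition allA : ribbonGraph :=
  @RibbonGraph allA_circle arrow n allA_attach allA_rot allA_opp fst
    allA_gt0 allA_rot_inj allA_rotP allA_oppK allA_opp_neq allA_edgeP
    allA_edge_surj.

Lemma loose_isolated (f : loose D) :
  [forall h, attach (r := allA) h != circle_at (inr f)].
Proof.
apply/forallP=> h; rewrite eq_sym circle_atE; apply/negP.
by case/connectP=> [[|q p]].
Qed.

Definition isolated_at (f : loose D) : isolated allA :=
  exist (fun v => [forall h, attach (r := allA) h != v]) _ (loose_isolated f).

(* The arc from an arrow h to the next one is the edge of D which contains
   [exit_end h]. *)
Definition mark (p : point D) : arc allA :=
  match p with
  | inl d => inl (arrow_at (if into o d then join d else d))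
  | inr f => inr (isolated_at f)
  end.

End AllA.

(* Main.v *)
From HB Require Import structures.
Require Import Defs.
From mathcomp Require Import all_boot all_order all_algebra.
From mathcomp Require Import boolp.
(* Several names of the definitions (cycle, walk, half) also occur in the
   libraries imported after them. *)
Import Defs.

Import GRing.Theory.
Local Open Scope ring_scope.
Local Open Scope quotient_scope.

Set Implicit Arguments.
Unset Strict Implicit.
Unset Printing Implicit Defensive.

(** The isomorphisms already exist at the level of chains: the two cubes have the
    same circles.  Let [I] be a set of crossings.  The all-A circles bound the
    vertex disks of the ribbon graph, and an edge of the diagram is precisely an
    arc of such a circle between two consecutive attaching places of bands.
    Following the boundary of the surface of the subgraph [I], one arrives by an
    arc at a crossing [x].  If [x] is not in [I] there is no band to follow, so
    one continues along the all-A circle, that is along the A-resolution of [x].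
    If [x] is in [I] one follows a side of the band to the other arrow of [x];
    because the band is glued compatibly with the orientation, the end where one
    arrives is the one joined to the starting end by the B-resolution.  Hence
    the boundary components of the surface of [I] are the components of the
    Kauffman state [I].

    Formally the map [mark], from the points of the diagram to the arcs, is
    surjective and identifies exactly the two points lying on one edge of the
    diagram; [linked_walk] says that it reflects and preserves connectedness, for
    every [I].  Taking preimages under [mark] is therefore a bijection from the
    boundary components to the state circles ([circlesE]), the same injective map
    of sets at all the vertices of the cube.  Such a map carries the generators,
    the coefficients of the differential, the gradings and the marked circle of
    one cube to those of the other (the lemmas on [state_map]); the only choice in
    the coefficients, the order in which the two circles of a merge or a split
    are listed, does not matter since [m] and [Delta] are symmetric.  Finally, a
    bijection of bases compatible with the differentials and with the gradings up
    to a translation induces an isomorphism in homology ([homology_iso]). *)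

(** * Isomorphisms of quotients and of homology groups *)

Section QuotientIso.
Variables (A B : zmodType) (I : zmodClosed A) (J : zmodClosed B).
Variables (f : {additive A -> B}) (g : B -> A).
Hypothesis gK : cancel g f.
Hypothesis fIJ : forall x, (f x \in J) = (x \in I).

Definition quot_map (x : Quotient.quot I) : Quotient.quot J :=
  \pi_(Quotient.quot J) (f (repr x)).

Lemma quot_map_pi x :
  quot_map (\pi_(Quotient.quot I) x) = \pi_(Quotient.quot J) (f x).
Proof.
apply/eqP; rewrite -Quotient.idealrBE -raddfB fIJ Quotient.idealrBE.
by rewrite reprK.
Qed.

Lemma quot_map_zmod_morphism : zmod_morphism quot_map.
Proof.
move=> x y; rewrite -[x]reprK -[y]reprK -[_ - _]raddfB.
by rewrite !quot_map_pi !raddfB.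
Qed.

HB.instance Definition _ :=
  GRing.isZmodMorphism.Build (Quotient.quot I) (Quotient.quot J) quot_map
    quot_map_zmod_morphism.

(** Injectivity comes from [fIJ] alone, [f] reflecting membership in [J]. *)
Lemma quot_map_bij : bijective quot_map.
Proof.
exists (fun y => \pi_(Quotient.quot I) (g (repr y))) => [x|y].
  rewrite -[x]reprK quot_map_pi; apply/eqP.
  rewrite -Quotient.idealrBE -fIJ raddfB gK Quotient.idealrBE.
  by rewrite reprK.
by rewrite quot_map_pi gK reprK.
Qed.

(** Packed with the additive structure, so that the isomorphisms in all bidegrees
    can be collected into one family without a choice. *)
Definition quot_iso :
    {h : {additive Quotient.quot I -> Quotient.quot J} | bijective h} :=
  exist (fun h : {additive _ -> _} => bijective h) quot_map quot_map_bij.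

End QuotientIso.


Lemma cvalB (C : complex) (P : pred (gen C)) i j (z w : cycle P i j) :
  val (z - w) = val z - val w.
Proof. exact: raddfB. Qed.

Section BasisBijection.
Variables (C C' : complex) (P : pred (gen C)) (P' : pred (gen C')) (r s : int).
Variables (e : gen C -> gen C') (e' : gen C' -> gen C).
Hypotheses (eK : cancel e e') (e'K : cancel e' e).
Hypothesis eP : forall x, P' (e x) = P x.
Hypothesis e_bideg : forall x, bideg (e x) = ((bideg x).1 + r, (bideg x).2 + s).
Hypothesis e_dcoef : forall x y, dcoef (e x) (e y) = dcoef x y.

Definition transport (c : chain C) : chain C' := [ffun t => c (e' t)].
Definition transport_inv (c : chain C') : chain C := [ffun t => c (e t)].

Lemma transportK : cancel transport transport_inv.
Proof. by move=> c; apply/ffunP=> t; rewrite !ffunE eK. Qed.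

Lemma transport_invK : cancel transport_inv transport.
Proof. by move=> c; apply/ffunP=> t; rewrite !ffunE e'K. Qed.

Lemma transportB c d : transport (c - d) = transport c - transport d.
Proof. by apply/ffunP=> t; rewrite !ffunE. Qed.

Lemma diff_transport c : diff (transport c) = transport (diff c).
Proof.
apply/ffunP=> t; rewrite !ffunE (reindex e) /=; last by exists e' => x _.
by apply: eq_bigr => x _; rewrite ffunE eK -{1}(e'K t) e_dcoef.
Qed.

Lemma bideg_shift x i j :
  (bideg (e x) == (i, j)) = (bideg x == (i - r, j - s)).
Proof.
rewrite e_bideg; case: (bideg x) => a b.
by rewrite !xpair_eqE !(eq_sym _ (_ - _)) !subr_eq !(eq_sym (_ + _)).
Qed.

Lemma homogeneous_transport i j c :
  homogeneous P' i j (transport c) = homogeneous P (i - r) (j - s) c.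
Proof.
apply/forallP/forallP=> hc x.
  by have := hc (e x); rewrite ffunE eK eP bideg_shift.
by rewrite ffunE -[x in bideg x]e'K bideg_shift -[x in P' x]e'K eP.
Qed.

Lemma cycles_transport i j c :
  (transport c \in cycles P' i j) = (c \in cycles P (i - r) (j - s)).
Proof.
rewrite !unfold_in homogeneous_transport diff_transport; congr (_ && _).
apply/eqP/eqP=> [E|->]; last by apply/ffunP=> t; rewrite !ffunE.
by rewrite -(transportK (diff c)) E; apply/ffunP=> t; rewrite !ffunE.
Qed.

Section Degree.
Variables i j : int.
Local Notation Z := (cycle P (i - r) (j - s)).
Local Notation Z' := (cycle P' i j).

Lemma cycle_map_subproof (z : Z) : transport (val z) \in cycles P' i j.
Proof. by rewrite cycles_transport (valP z). Qed.

Definition cycle_map (z : Z) : Z' := Cycle (cycle_map_subproof z).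

Lemma cycle_inv_subproof (z : Z') :
  transport_inv (val z) \in cycles P (i - r) (j - s).
Proof. by rewrite -cycles_transport transport_invK (valP z). Qed.

Definition cycle_inv (z : Z') : Z := Cycle (cycle_inv_subproof z).

Lemma cycle_invK : cancel cycle_inv cycle_map.
Proof. by move=> z; apply/val_inj; rewrite /= transport_invK. Qed.

Lemma cycle_map_zmod_morphism : zmod_morphism cycle_map.
Proof. move=> z w; apply/val_inj/(etrans _ (esym (cvalB _ _))).
by rewrite -transportB -cvalB.
Qed.

HB.instance Definition _ :=
  GRing.isZmodMorphism.Build Z Z' cycle_map cycle_map_zmod_morphism.

Lemma boundaries_cycle_map z :
  (cycle_map z \in @boundaries C' P' i j) =
  (z \in @boundaries C P (i - r) (j - s)).
Proof.
rewrite !unfold_in; apply/asboolP/asboolP=> [[y hy dy]|[y hy dy]].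
  exists (transport_inv y).
    by rewrite addrAC -homogeneous_transport transport_invK.
  by apply: (can_inj transportK); rewrite -diff_transport transport_invK.
exists (transport y); first by rewrite homogeneous_transport addrAC.
by rewrite diff_transport dy.
Qed.

Definition homology_iso_at :=
  @quot_iso Z Z'
    (GRing.ZmodClosed.clone Z (@boundaries C P (i - r) (j - s)) _)
    (GRing.ZmodClosed.clone Z' (@boundaries C' P' i j) _)
    cycle_map cycle_inv cycle_invK boundaries_cycle_map.

End Degree.

(** The degree is translated on one side by [shift], acting on the homology, and on
    the other by the bidegrees of the generators. *)
Lemma homology_iso :
  bigraded_iso (shift r s (homology P)) (homology P').
Proof.
exists (fun i j => sval (homology_iso_at i j)) => i j.
exact: svalP (homology_iso_at i j).
Qed.

End BasisBijection.

(** * Cubes with corresponding circles *)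

(** [phi] is one map for the whole cube: a circle untouched by a hypercube edge has
    the same image at both ends, so that the tensor factors on which [d_xi] is the
    identity are matched consistently. *)
Section CubeMap.
Variables (n : nat) (X Y : finType).
Variables (circX : {set 'I_n} -> {set {set X}}).
Variables (circY : {set 'I_n} -> {set {set Y}}).
Variables (phi : {set Y} -> {set X}) (phi' : {set X} -> {set Y}).
Hypothesis phiK : cancel phi phi'.
Hypothesis circE : forall I, circX I = phi @: circY I.

Let phi_inj : injective phi := can_inj phiK.

Lemma imset_phiK :
  cancel (fun S : {set {set Y}} => phi @: S) (fun S => phi' @: S).
Proof.
move=> S; rewrite -imset_comp -[RHS]imset_id.
by apply: eq_imset => B /=; rewrite phiK.
Qed.

Lemma imset_phi'K I (S : {set {set X}}) :
  S \subset circX I -> phi @: (phi' @: S) = S.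
Proof.
move=> /subsetP SI; rewrite -imset_comp -[RHS]imset_id.
apply: eq_in_imset => B /SI; rewrite circE => /imsetP[B' _ ->] /=.
by rewrite phiK.
Qed.

Lemma state_map_subproof (s : state circY) :
  phi @: (val s).2 \subset circX (val s).1.
Proof. by rewrite circE imsetS // (valP s). Qed.

Definition state_map (s : state circY) : state circX :=
  exist (fun s : {set 'I_n} * {set {set X}} => s.2 \subset circX s.1)
    ((val s).1, phi @: (val s).2) (state_map_subproof s).

Lemma state_inv_subproof (s : state circX) :
  phi' @: (val s).2 \subset circY (val s).1.
Proof.
by rewrite -(imset_phiK (circY _)) -circE imsetS // (valP s).
Qed.

Definition state_inv (s : state circX) : state circY :=
  exist (fun s : {set 'I_n} * {set {set Y}} => s.2 \subset circY s.1)
    ((val s).1, phi' @: (val s).2) (state_inv_subproof s).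

Lemma state_mapK : cancel state_map state_inv.
Proof. by case=> [[I S] SI]; apply/val_inj; rewrite /= imset_phiK. Qed.

Lemma state_invK : cancel state_inv state_map.
Proof.
by case=> [[I S] SI]; apply/val_inj; rewrite /= (imset_phi'K SI).
Qed.

Lemma imset_phiD (A B : {set {set Y}}) :
  phi @: (A :\: B) = phi @: A :\: phi @: B.
Proof.
apply/setP=> c; apply/imsetP/idP=> [[b]|].
  by rewrite inE => /andP[nB bA] ->; rewrite inE !mem_imset // nB.
by case/setDP=> /imsetP[b bA ->]; rewrite mem_imset // => nB; exists b;
  rewrite // inE nB.
Qed.

Lemma state_bideg_map s : state_bideg (state_map s) = state_bideg s.
Proof.
rewrite /state_bideg /= /vertex_of /plus /= circE -imset_phiD.
by rewrite !card_imset.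
Qed.

(** The part of [edge_coef] which concerns the affected circles, with the lists of
    these circles as arguments, so that they can be permuted. *)
Definition local_coef (T : eqType) (p q : pred T) (u v : seq T) : int :=
  match u, v with
  | [:: a; b], [:: c] => mcoef (p a) (p b) (q c)
  | [:: c], [:: a; b] => Dcoef (p c) (q a) (q b)
  | _, _ => 0
  end.

Lemma perm_eq2 (T : eqType) (u : seq T) a b :
  perm_eq u [:: a; b] -> u = [:: a; b] \/ u = [:: b; a].
Proof.
move=> E; move: (perm_size E) (E); case: u E => [|x [|y [|]]] // _ _ E.
have:= perm_mem E x; rewrite !inE eqxx /= => /esym /orP[] /eqP xE; subst x.
  by move: E; rewrite perm_cons => /perm_small_eq -> //; left.
have: perm_eq [:: b; y] [:: b; a]
  by rewrite (permPr (permEl (perm_catC [:: b] [:: a]))).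
by rewrite perm_cons => /perm_small_eq -> //; right.
Qed.

(** The multiplication is commutative. *)
Lemma local_coef_perml (T : eqType) (p q : pred T) u u' v :
  perm_eq u u' -> local_coef p q u v = local_coef p q u' v.
Proof.
case: u' => [|a [|b [|c u']]] uE; try by rewrite (perm_small_eq _ uE).
  by case: (perm_eq2 uE) => -> //=; case: v => [|c []] //=;
    case: (p a) (p b) => [] [].
by case: u uE => [|x [|y [|z u]]] // /perm_size.
Qed.

(** The comultiplication is cocommutative. *)
Lemma local_coef_permr (T : eqType) (p q : pred T) u v v' :
  perm_eq v v' -> local_coef p q u v = local_coef p q u v'.
Proof.
case: v' => [|a [|b [|c v']]] vE; try by rewrite (perm_small_eq _ vE).
  by case: (perm_eq2 vE) => -> //=; case: u => [|c []] //=;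
    case: (p c) (q a) (q b) => [] [] [].
by case: v vE => [|x [|y [|z v]]] // /perm_size //; case: u => [|? [|? []]].
Qed.

(** Enumerating the images by [phi] may list two circles in the opposite order,
    whence the two preceding lemmas. *)
Lemma local_coef_enum (p q : pred {set X}) (A B : {set {set Y}}) :
  local_coef p q (enum (phi @: A)) (enum (phi @: B)) =
  local_coef (p \o phi) (q \o phi) (enum A) (enum B).
Proof.
have enumE (S : {set {set Y}}) : perm_eq (enum (phi @: S)) (map phi (enum S)).
  apply: uniq_perm; rewrite ?enum_uniq ?map_inj_uniq ?enum_uniq // => c.
  rewrite mem_enum; apply/imsetP/mapP => -[b bS ->]; exists b => //;
    by rewrite mem_enum in bS *.
rewrite (local_coef_perml _ _ _ (enumE A)) (local_coef_permr _ _ _ (enumE B)).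
by case: (enum A) (enum B) => [|a [|b []]] // [|c [|d []]].
Qed.

Lemma edge_coef_map s t : edge_coef (state_map s) (state_map t) = edge_coef s t.
Proof.
have coefE n' (Z : finType) (circ : {set 'I_n'} -> {set {set Z}})
    (x y : state circ) : edge_coef x y =
  let P := circ (vertex_of x) in let Q := circ (vertex_of y) in
  if plus x :&: (P :&: Q) != plus y :&: (P :&: Q) then 0 else
  local_coef [in plus x] [in plus y] (enum (P :\: Q)) (enum (Q :\: P)).
  by [].
rewrite !coefE /= /vertex_of /plus /= !circE -!imset_phiD.
rewrite -!imsetI; try by move=> ? ? _ _; exact: phi_inj.
rewrite (inj_eq (imset_inj phi_inj)); case: ifP => // _.
rewrite local_coef_enum.
case: (enum _) (enum _) => [|a [|b []]] // [|c [|d []]] //=;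
  by rewrite !mem_imset.
Qed.

Lemma cube_coef_map s t : cube_coef (state_map s) (state_map t) = cube_coef s t.
Proof. by apply: eq_bigr => k _; rewrite edge_coef_map. Qed.

(** The marked points are compatible when they lie on corresponding circles. *)
Lemma marked_map p p' s :
  (forall B, B \in circY (vertex_of s) -> (p \in phi B) = (p' \in B)) ->
  marked p (state_map s) = marked p' s.
Proof.
move=> pE; apply/forall_inP/forall_inP=> H B BI.
  have := H (phi B); rewrite pE // /plus /= mem_imset //; apply.
  by rewrite /= circE mem_imset.
move: BI; rewrite /= /vertex_of /= circE => /imsetP[B' BI ->].
by rewrite pE // /plus /= mem_imset //; exact: H.
Qed.

End CubeMap.

(** * Components under a surjection *)
Section Preimage.
Variables (T T' : finType) (f : T -> T') (e : rel T) (e' : rel T').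
Hypothesis f_surj : forall y, exists x, f x = y.

Lemma preimsetK : cancel (fun B : {set T'} => f @^-1: B) (fun A => f @: A).
Proof.
move=> B; apply/setP=> y; apply/imsetP/idP=> [[x]|yB].
  by rewrite inE => xB ->.
by have [x fx] := f_surj y; exists x; rewrite ?inE fx.
Qed.

Hypothesis eE : forall x y, connect e x y = connect e' (f x) (f y).

Lemma components_preim :
  components e = (fun B : {set T'} => f @^-1: B) @: components e'.
Proof.
have E x : [set y | connect e x y] = f @^-1: [set y | connect e' (f x) y].
  by apply/setP=> y; rewrite !inE eE.
apply/setP=> A; apply/imsetP/imsetP=> [[x _ ->]|[_ /imsetP[y _ ->] ->]].
  by exists [set y | connect e' (f x) y]; rewrite ?E ?imset_f.
by have [x fx] := f_surj y; exists x; rewrite ?inE // E fx.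
Qed.

End Preimage.

(** * Boundary components and state circles *)

(** A step is the composite of [rot] with the involution which crosses the bands of
    [I].  Injectivity makes connectedness along [walk] symmetric, which is needed
    since a state circle may be followed in either direction. *)
Lemma walk_inj (G : ribbonGraph) I : injective (@walk G I).
Proof.
have edge_opp (h : half G) : edge (opp h) = edge h.
  by apply/eqP; rewrite eq_sym edgeP eqxx orbT.
pose cross (g : half G) := if edge g \in I then opp g else g.
have crossK : involutive cross.
  by move=> g; rewrite /cross; case gI: (edge g \in I);
    rewrite ?edge_opp gI ?oppK.
move=> [h|v] [h'|v'] //=; first by case=> /(inv_inj crossK)/rot_inj ->.
Qed.

Section Boundaries.
Variables (D : linkDiagram) (o : allA_orientation D).
Local Notation G := (allA o).

(** A vertex disk without bands is bounded by an all-A circle without crossings,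
    because a circle through a dart carries an arrow of its crossing. *)
Lemma mark_surj (a : arc G) : exists p, mark o p = a.
Proof.
case: a => [h|[v iso_v]].
  by exists (inl (exit_end o h)); rewrite /= exit_into exit_arrow.
have [p _ pv] := imsetP (valP v); have {}pv : v = circle_at p by apply/val_inj.
case: p pv => [d|f] pv; last by exists (inr f); congr inr; apply/val_inj.
have /negP[] := forallP iso_v (arrow_at d).
rewrite /= pv circle_atE (sym_connect_sym (@linked_sym D set0)).
exact: linked_over.
Qed.

Lemma mark_join d : mark o (inl (join d)) = mark o (inl d).
Proof. by rewrite /= into_join joinK; case: (into o d). Qed.

(** The only distinct points with the same mark are the two ends of an edge of the
    diagram, and these are linked in every Kauffman state. *)
Lemma mark_eq I p q : mark o p = mark o q -> connect (linked I) p q.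
Proof.
have conn_join d : connect (linked I) (inl d) (inl (join d)).
  by apply: connect1; rewrite /= eqxx.
have sym := sym_connect_sym (@linked_sym D I).
(* the end by which the oriented circle enters the edge of [d] *)
pose ex d := if into o d then join d else d.
have ex_into d : into o (ex d) = false.
  by rewrite /ex; case od: (into o d); rewrite ?into_join od.
have conn_ex d : connect (linked I) (inl d) (inl (ex d)).
  by rewrite /ex; case: ifP.
case: p q => [d|f] [d'|f'] //=.
  move/(congr1 (fun a : arc G => if a is inl h then exit_end o h else ex d)).
  rewrite -!/(ex _) !exitK // => E.
  by apply: connect_trans (conn_ex d) _; rewrite sym E; exact: conn_ex.
move/(congr1 (fun a : arc G =>
  if a is inr v then val v else circle_at (inr f))).
move/eqP; rewrite circle_atE => /connectP[[|? ?]] //= _ ->.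
exact: connect0.
Qed.

(** The compatibility of the bands with the orientation says that the
    B-resolution, like the A-resolution, joins an incoming end to an outgoing
    one. *)
Lemma into_resB d : into o (resB d) = ~~ into o d.
Proof.
have rA x : into o (x, 0) = ~~ into o (x, 1) /\
            into o (x, 2%:R) = ~~ into o (x, 3%:R).
  by split; rewrite -into_resA; congr (into o (_, _)); apply/val_inj.
have Bx x := into_band o x.
case: d => x k; have [r0 r2] := rA x.
have E (a b : 'I_4) : val a = val b -> into o (x, a) = into o (x, b).
  by move=> /val_inj ->.
rewrite /resB /=; case: k => [[|[|[|[|k]]]] hk] //=.
- by rewrite (E _ 3%:R) // [X in ~~ X](E _ 0) // r0 negbK Bx.
- by rewrite (E _ 2%:R) // [X in ~~ X](E _ 1) // r2 Bx.
- by rewrite (E _ 1) // [X in ~~ X](E _ 2%:R) // r2 negbK Bx.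
- by rewrite (E _ 0) // [X in ~~ X](E _ 3%:R) // r0 Bx.
Qed.

Lemma into_smooth I d : into o (smooth I d) = ~~ into o d.
Proof. by rewrite /smooth; case: ifP; rewrite ?into_resB ?into_resA. Qed.

(** The B-resolution is what the band does: it leads to the other arrow. *)
Lemma arrow_resB (d : dart (ncross D)) :
  arrow_at (resB d) = allA_opp (arrow_at d).
Proof. by case: d => x [[|[|[|[|k]]]] hk]. Qed.

(** Passing a crossing in the direction of the orientation is one step of the walk;
    in the opposite direction it would be a step backwards. *)
Lemma mark_smooth I d : into o d ->
  mark o (inl (smooth I d)) = walk (G := G) I (mark o (inl d)).
Proof.
move=> od; rewrite /= into_smooth od /allA_rot exitK ?into_join ?od // joinK.
by congr inl; rewrite /smooth /=; case: ifP; rewrite ?arrow_resB ?arrow_resA.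
Qed.

(** Every step of the walk comes from a path in the diagram, since each edge has an
    end at which the oriented circle enters a crossing. *)
Lemma walk_mark I p : exists2 q,
  walk (G := G) I (mark o p) = mark o q & connect (linked I) p q.
Proof.
case: p => [d|f]; last by exists (inr f).
pose d' := if into o d then d else join d.
have od' : into o d'.
  by rewrite /d'; case od: (into o d); rewrite ?into_join od.
have md' : mark o (inl d') = mark o (inl d).
  by rewrite /d'; case: ifP => // _; rewrite mark_join.
exists (inl (smooth I d')); first by rewrite mark_smooth // md'.
apply: connect_trans (mark_eq I (esym md')) _.
by apply: connect1; rewrite /= eqxx orbT.
Qed.

Lemma linked_walk I p q :
  connect (linked I) p q =
  connect (frel (walk (G := G) I)) (mark o p) (mark o q).
Proof.
have sym := fconnect_sym (@walk_inj G I).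
apply/idP/idP => [/connectP[l]|/connectP[l]].
  elim: l p => [|z l IHl] p; first by move=> _ ->.
  case/andP=> pz /IHl IH /IH; apply: connect_trans => {IH IHl}.
  case: p z pz => [d|f] [d'|f'] // /orP[] /eqP ->; first by rewrite mark_join.
  case od: (into o d); first by rewrite mark_smooth // fconnect1.
  have oI : into o (smooth I d) by rewrite into_smooth od.
  have mE : walk (G := G) I (mark o (inl (smooth I d))) = mark o (inl d).
    rewrite -mark_smooth //; congr (mark o (inl _)).
    rewrite /smooth; case dI: (d.1 \in I).
      by rewrite [(resB d).1]/= dI resBK.
    by rewrite [(resA d).1]/= dI resAK.
  by rewrite sym -mE fconnect1.
elim: l p => [|b l IHl] p /=.
  by move=> _ E; apply: mark_eq.
case/andP=> /eqP <-; have [z -> pz] := walk_mark I p.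
by move=> /IHl IH /IH; apply: connect_trans.
Qed.

Lemma circlesE I :
  circles I = (fun B : {set arc G} => mark o @^-1: B) @: faces (G := G) I.
Proof. exact: components_preim mark_surj (linked_walk I). Qed.

End Boundaries.

Theorem theorem1p1 (D : linkDiagram) (o : allA_orientation D) :
  let sh := shift (- (n_minus D)%:Z)
                  ((n_plus D)%:Z - 2 * (n_minus D)%:Z) in
  bigraded_iso (sh (Kh (allA o))) (KhL D) /\
  (forall p : point D,
     bigraded_iso (sh (rKh (G := allA o) (mark o p))) (rKhL p)).
Proof.
move=> sh; have phiK := preimsetK (@mark_surj D o).
have eK := state_mapK phiK (circlesE o).
have e'K := state_invK phiK (circlesE o).
rewrite /sh {sh}; set r := (X in shift X); set s := (X in shift _ X).
have bidegE x : state_bideg (state_map (circlesE o) x) = state_bideg x.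
  exact: state_bideg_map phiK _ _.
split=> [|p].
  refine (@homology_iso (CKh (allA o)) (CKhL D) predT predT r s _ _ eK e'K _ _ _).
  - by [].
  - by move=> x; refine (congr1 (fun b => (b.1 + r, b.2 + s)) (bidegE x)).
  by move=> x y; refine (cube_coef_map phiK _ x y).
refine (@homology_iso (cshift 0 1 (CKh (allA o))) (cshift 0 1 (CKhL D))
  (marked (circ := faces (G := allA o)) (mark o p))
  (marked (circ := @circles D) p) r s _ _ eK e'K _ _ _).
- move=> x; refine (marked_map phiK _ (p' := mark o p) _) => B _.
  by rewrite inE.
- move=> x.
  refine (etrans (congr1 (fun b => (b.1 + r + 0, b.2 + s + 1)) (bidegE x)) _).
  by congr (_, _); exact: addrAC.
by move=> x y; refine (cube_coef_map phiK _ x y).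
Qed.
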